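(* Let $k\ge 3$ be an integer. Then, up to isomorphism, $K_{k+1,k+1}-PM$ is the unique graph $G$ satisfying the following three conditions: (1) $G$ is $k$-connected; (2) the independence number of $G$ is greater than $k$; (3) every independent set of vertices of $G$ of cardinality $k$ is a vertex cut of $G$ (i.e., deleting it leaves a disconnected graph).
   Context: All graphs are finite and simple. For an integer $s\ge 1$, $K_{s,s}-PM$ denotes the graph obtained from the complete bipartite graph $K_{s,s}$ (both partite sets of size $s$) by deleting all edges of a perfect matching of $K_{s,s}$. *)

(* Defs.v *)
From mathcomp Require Import all_boot.

Set Implicit Arguments.
Unset Strict Implicit.
Unset Printing Implicit Defensive.

Record sgraph := SGraph {
  vertex :> finType;
  adj : rel vertex;
  adj_sym : symmetric adj;
  adj_irrefl : irreflexive adj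
}.

Definition isomorphic (G H : sgraph) : Prop :=
  exists2 f : G -> H, bijective f & forall x y : G, adj (f x) (f y) = adj x y.

Section Graph.
Variable G : sgraph.
Implicit Types A S : {set G}.

Definition induced_adj A : rel G :=
  [rel x y | [&& x \in A, y \in A & adj x y]].

(* The subgraph induced by A is connected.  The empty subgraph counts as
   connected, but that case is irrelevant here: at most k vertices are ever
   deleted, from graphs with more than k vertices. *)
Definition connected_on A : bool :=
  [forall x in A, forall y in A, connect (induced_adj A) x y].

Definition vertex_cut S : bool := ~~ connected_on (~: S).

Definition k_connected (k : nat) : bool :=
  (k < #|G|) && [forall S : {set G}, (#|S| < k) ==> connected_on (~: S)].

Definition independent S : bool :=
  [forall x in S, forall y in S, ~~ adj x y].

Definition independence_number : nat :=
  \max_(S : {set G} | independent S) #|S|.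

End Graph.

Section KssPM.
Variable s : nat.
Implicit Types x y : ('I_s + 'I_s)%type.

(* Edges of K_{s,s}; its partite sets are the two summands of 'I_s + 'I_s. *)
Definition Kss_adj x y : bool :=
  match x, y with
  | inl _, inr _ | inr _, inl _ => true
  | _, _ => false
  end.

(* The perfect matching {inl i, inr i}.  Permuting one partite set carries any
   perfect matching of K_{s,s} to this one, so the choice is immaterial. *)
Definition PM_adj x y : bool :=
  match x, y with
  | inl i, inr j | inr i, inl j => i == j
  | _, _ => false
  end.

Definition KssPM_adj x y : bool := Kss_adj x y && ~~ PM_adj x y.

Lemma KssPM_sym : symmetric KssPM_adj.
Proof. by move=> [i|i] [j|j]; rewrite /KssPM_adj //= eq_sym. Qed.

Lemma KssPM_irrefl : irreflexive KssPM_adj.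
Proof. by case. Qed.

Definition KssPM : sgraph := SGraph KssPM_sym KssPM_irrefl.

End KssPM.

(* Main.v *)
(** Let [T] be an independent set of size k+1.  For each [t] in [T] the cut
    [T :\ t] yields a component of [G - T] not adjacent to [t], whose
    neighbourhood is then exactly [T :\ t] by k-connectivity.  Choose one vertex
    [b t] in each of these components.  For [j] in [T] the set [b @: (T :\ j)]
    is again an independent k-set, hence a cut; as k >= 3, everything outside
    it other than [j] lies in one component, so [j] is isolated: all neighbours
    of [j] are among the chosen vertices.  Since the choice of the [b t] within
    their components was arbitrary, these components are singletons, and they
    exhaust [G - T]. *)

Require Import Defs.
From mathcomp Require Import all_boot.

Set Implicit Arguments.
Unset Strict Implicit.
Unset Printing Implicit Defensive.

(** * Connectivity as a closure property, and independent sets *)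

Section Connectivity.
Variable G : sgraph.
Implicit Types (A S D T : {set G}) (x y : G).

Lemma induced_adjE A x y :
  induced_adj A x y = [&& x \in A, y \in A & adj x y].
Proof. by []. Qed.

Lemma induced_connect_sym A : connect_sym (@induced_adj G A).
Proof.
apply: sym_connect_sym => x y.
by rewrite !induced_adjE adj_sym andbCA.
Qed.

(** This form replaces paths by sets: to refute connectivity it suffices to give one [D] that edges
    into [A] cannot leave. For the converse, [D] is the set of vertices reachable from [x] inside
    [A]. *)
Lemma connected_onP A :
  reflect (forall D, (forall x y, x \in D -> y \in A -> adj x y -> y \in D) ->
             forall x y, x \in D -> x \in A -> y \in A -> y \in D)
          (connected_on A).
Proof.
apply: (iffP idP) => [cA D clD x y xD xA yA | clA].
  have clD' : closed (@induced_adj G A) (mem D).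
    apply: intro_closed; first exact: induced_connect_sym.
    by move=> u v /and3P[_ vA uv] uD; apply: clD uv.
  move/forall_inP: cA => /(_ x xA) /forall_inP /(_ y yA) xy.
  by rewrite -(closed_connect clD' xy).
apply/forall_inP => x xA; apply/forall_inP => y yA.
have := clA [set z | (z \in A) && connect (induced_adj A) x z].
move=> /(_ _ x y); rewrite !inE xA yA connect0; apply=> // u v.
rewrite !inE => /andP[uA xu] vA uv; rewrite vA.
by apply: connect_trans xu (connect1 _); rewrite induced_adjE uA vA.
Qed.

Lemma independentP S :
  reflect {in S &, forall x y, ~~ adj x y} (independent S).
Proof.
apply: (iffP forall_inP) => [h x y xS yS | h x xS].
  by move/forall_inP: (h x xS); apply.
by apply/forall_inP => y; apply: h.
Qed.

Lemma independent_subset S T : S \subset T -> independent T -> independent S.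
Proof.
move=> /subsetP sST /independentP iT; apply/independentP => x y xS yS.
by apply: iT; apply: sST.
Qed.

Lemma independent_of_card n :
  n <= independence_number G -> exists2 T : {set G}, independent T & #|T| = n.
Proof.
have i0 : @independent G set0.
  by apply/independentP => x y; rewrite inE.
rewrite /independence_number.
have [|T iT ->] := @eq_bigmax_cond _ [pred S : {set G} | independent S] (fun S => #|S|).
  by apply/card_gt0P; exists set0.
move=> /card_geqP[s [us <- sT]]; exists [set x in s].
  by apply: independent_subset iT; apply/subsetP => x; rewrite inE; apply: sT.
by rewrite cardsE; apply/card_uniqP.
Qed.

(** The form in which k-connectivity is used: fewer than [k] deleted vertices cannot confine a set
    that is closed under adjacency outside them. *)
Lemma k_connected_closed k S D x y :
  k_connected G k -> #|S| < k ->
  (forall u v, u \in D -> v \notin S -> adj u v -> v \in D) ->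
  x \in D -> x \notin S -> y \notin S -> y \in D.
Proof.
case/andP=> _ /forallP /(_ S) /implyP cS /cS /connected_onP clS clD xD xS yS.
by apply: (clS D _ x y); rewrite ?inE // => u v uD; rewrite inE; apply: clD.
Qed.

End Connectivity.

(** * Components of [G - T] for an independent set [T] of size [k.+1] *)

Section Transversal.
Variables (G : sgraph) (k : nat) (T : {set G}).
Hypotheses (k_ge3 : 3 <= k) (kG : k_connected G k).
Hypotheses (indT : independent T) (cardT : #|T| = k.+1).
Hypothesis cutG :
  forall S : {set G}, independent S -> #|S| = k -> vertex_cut S.
Implicit Types (x y t : G) (b : G -> G).

(** For [x] outside [T] this is its component in [G - T]; for [x] in [T] it degenerates to
    [[set x]], hence the condition [x \notin T] in [avoiding]. *)
Definition comp x : {set G} := [set y | connect (induced_adj (~: T)) x y].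

Definition avoiding t x : bool :=
  (x \notin T) && [forall y in comp x, ~~ adj t y].

Lemma comp_refl x : x \in comp x.
Proof. by rewrite inE. Qed.

Lemma comp_eq x y : y \in comp x -> comp y = comp x.
Proof.
rewrite inE => xy; apply/setP => z; rewrite !inE.
by rewrite (same_connect (@induced_connect_sym _ _) xy).
Qed.

Lemma comp_closed x y z :
  y \in comp x -> y \notin T -> z \notin T -> adj y z -> z \in comp x.
Proof.
rewrite !inE => xy yT zT yz; apply: connect_trans xy (connect1 _).
by rewrite induced_adjE !inE yT zT.
Qed.

Lemma comp_notin x y : x \notin T -> y \in comp x -> y \notin T.
Proof.
move=> xT; rewrite inE => xy.
have cl : closed (@induced_adj G (~: T)) (mem (~: T)).
  by move=> u v /and3P[-> ->].
by move: (closed_connect cl xy); rewrite /= !inE xT => <-.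
Qed.

Lemma avoiding_comp t x y : avoiding t x -> y \in comp x -> avoiding t y.
Proof.
by move=> /andP[xT av] xy; rewrite /avoiding (comp_eq xy) (comp_notin xT xy).
Qed.

Lemma card_T_setD1 t : t \in T -> #|T :\ t| = k.
Proof. by move=> tT; apply/eqP; rewrite -eqSS -cardT (cardsD1 t T) tT. Qed.

(** Some vertex [z] of the disconnected graph [G - (T :\ t)] is not joined to [t]. It lies outside
    [T], and a neighbour of [t] in its component would join it to [t] after all. *)
Lemma exists_avoiding t : t \in T -> exists x, avoiding t x.
Proof.
move=> tT; pose A := ~: (T :\ t); pose e := @induced_adj G A.
have tA : t \in A by rewrite !inE eqxx.
have [z zA zt] : exists2 z, z \in A & ~~ connect e z t.
  have := cutG (independent_subset (subsetDl _ _) indT) (card_T_setD1 tT).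
  rewrite /vertex_cut => /forall_inPn[x xA /forall_inPn[y yA xy]].
  have [xt | ] := boolP (connect e x t); last by exists x.
  exists y => //; apply: contra xy => yt; apply: connect_trans xt _.
  by rewrite induced_connect_sym.
have zT : z \notin T.
  by apply: contra zt => zT; move: zA; rewrite !inE zT andbT negbK => /eqP->.
exists z; rewrite /avoiding zT; apply/forall_inP => y zy.
apply: contra zt => ty; have := comp_notin zT zy => yT.
have yA : y \in A by rewrite !inE (negbTE yT) andbF.
have : connect e y t by apply: connect1; rewrite /e induced_adjE yA tA adj_sym.
apply: connect_trans; move: zy; rewrite inE; apply: connect_sub => u v.
move=> /and3P[]; rewrite !inE => uT vT uv; apply: connect1.
by rewrite /e induced_adjE !inE (negbTE uT) (negbTE vT) !andbF.
Qed.

(** If neither [s] nor [t] had a neighbour in [comp x], the remaining [k - 1] vertices of [T] would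
    separate this component from [t]. *)
Lemma avoiding_touch s t x :
    s \in T -> t \in T -> s != t -> avoiding t x ->
  exists2 y, y \in comp x & adj s y.
Proof.
move=> sT tT st /andP[xT /forall_inP av].
apply/exists_inP; apply: contraT => /exists_inPn noadj.
have card_lt : #|T :\ t :\ s| < k.
  by rewrite -(card_T_setD1 tT) [X in _ < X](cardsD1 s) !inE st sT.
have : t \in comp x.
  apply: (k_connected_closed kG card_lt _ (comp_refl x)).
  - move=> u v ux; rewrite !inE => vST uv.
    case: (boolP (v \in T)) vST => vT.
      rewrite andbT negb_and !negbK => /orP[/eqP vs|/eqP vt].
        by move: (noadj u ux); rewrite -vs adj_sym uv.
      by move: (av u ux); rewrite -vt adj_sym uv.
    by have := comp_closed ux (comp_notin xT ux) vT uv; rewrite inE.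
  - by rewrite !inE (negbTE xT) !andbF.
  - by rewrite !inE eqxx andbF.
by move/(comp_notin xT); rewrite tT.
Qed.

Definition transversal b := {in T, forall t, avoiding t (b t)}.

Lemma transversal_notin b t : transversal b -> t \in T -> b t \notin T.
Proof. by move=> tb /tb /andP[]. Qed.

(** For [s != t], the vertex [s] has a neighbour in [comp (b t)] but none in [comp (b s)]. *)
Lemma transversal_comp_inj b s t :
  transversal b -> s \in T -> t \in T -> comp (b s) = comp (b t) -> s = t.
Proof.
move=> tb sT tT cst; apply/eqP/negPn/negP => st.
have [y] := avoiding_touch sT tT st (tb t tT).
rewrite -cst => ys; have /andP[_ /forall_inP /(_ y ys)] := tb s sT.
by move/negP.
Qed.

Lemma transversal_inj b : transversal b -> {in T &, injective b}.
Proof.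
by move=> tb s t sT tT est; apply: transversal_comp_inj tb sT tT _; rewrite est.
Qed.

Lemma transversal_nadj b s t :
  transversal b -> s \in T -> t \in T -> ~~ adj (b s) (b t).
Proof.
move=> tb sT tT; have [->|st] := eqVneq s t; first by rewrite adj_irrefl.
apply: contra st => st; apply/eqP/(transversal_comp_inj tb sT tT)/esym/comp_eq.
by apply: comp_closed st; rewrite ?comp_refl ?transversal_notin.
Qed.

(** A neighbour [w] of [j] outside [U] would make [G - U] connected, although [U] is an independent
    [k]-set and hence a cut. Everything is reached from [b j]: first its component, then [T :\ j],
    then the other vertices outside [T], and finally [j] through [w]. *)
Lemma adj_transversal b j w :
  transversal b -> j \in T -> adj j w -> w \in b @: (T :\ j).
Proof.
move=> tb jT jw; apply/negPn/negP => wU.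
set U := b @: (T :\ j) in wU.
have TU t : t \in T -> t \notin U.
  apply: contraL => /imsetP[s]; rewrite !inE => /andP[_ sT] ->.
  exact: transversal_notin.
have bjU : b j \notin U.
  apply/negP => /imsetP[t]; rewrite !inE => /andP[tj tT] /(transversal_inj tb).
  by move=> /(_ jT tT) jt; rewrite jt eqxx in tj.
have bjT := transversal_notin tb jT.
have indU : independent U.
  apply/independentP => _ _ /imsetP[s + ->] /imsetP[t + ->].
  by rewrite !inE => /andP[_ sT] /andP[_ tT]; apply: transversal_nadj.
have cardU : #|U| = k.
  rewrite card_in_imset ?card_T_setD1 // => s t.
  by rewrite !inE => /andP[_ sT] /andP[_ tT]; apply: transversal_inj.
have := cutG indU cardU; rewrite /vertex_cut => /negP; apply.
set e := @induced_adj G (~: U).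
have stepU x y : x \notin U -> y \notin U -> adj x y -> connect e x y.
  by move=> xU yU xy; apply: connect1; rewrite /e induced_adjE !inE xU yU.
(* The vertices of [U] lie in components other than that of [b j], so deleting [U] leaves this
   component intact. *)
have compU y : y \in comp (b j) -> y \notin U.
  move=> yj; apply/negP => /imsetP[t]; rewrite !inE => /andP[tj tT] ybt.
  rewrite ybt in yj; have tj' := transversal_comp_inj tb tT jT (comp_eq yj).
  by rewrite tj' eqxx in tj.
have compj x : x \in comp (b j) -> connect e (b j) x.
  move=> xj; have := xj; rewrite inE => /connectP[p].
  elim/last_ind: p x xj => [x _ _ ->|p y IHp x xj]; first exact: connect0.
  rewrite rcons_path last_rcons => /andP[pp ep] xy; rewrite {x}xy in xj *.
  have lj : last (b j) p \in comp (b j) by rewrite inE; apply/connectP; exists p.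
  apply: connect_trans (IHp _ lj pp erefl) (stepU _ _ _ _ _); try exact: compU.
  by move/and3P: ep => [].
have reachT t : t \in T -> t != j -> connect e (b j) t.
  move=> tT tj; have [y yj ty] := avoiding_touch tT jT tj (tb j jT).
  have ey := compj y yj; apply: connect_trans ey _.
  by apply: stepU; rewrite 1?adj_sym ?(TU t) ?compU.
(* The unreached part of a component of G - T is separated from the rest by [j]
   and the at most one vertex of [U] in that component. *)
have reachC v : v \notin T -> v \notin U -> connect e (b j) v.
  move=> vT vU; apply/negPn/negP => nv.
  pose D := [set x in comp v | (x \notin U) && ~~ connect e (b j) x].
  pose S := j |: (U :&: comp v).
  (* The set [S] has at most two vertices, so [k >= 3] is exactly what makes it too small to
     separate. *)
  have cardS : #|S| < k.
    apply: leq_ltn_trans k_ge3; rewrite -[2]/(1 + 1).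
    apply: leq_trans (leq_card_setU _ _) _; rewrite cards1 leq_add2l.
    apply/card_le1_eqP => x y; rewrite !in_setI.
    move=> /andP[/imsetP[s + xs] xv] /andP[/imsetP[t + yt] yv].
    rewrite !inE => /andP[_ sT] /andP[_ tT].
    rewrite xs yt; congr b; apply: transversal_comp_inj tb _ _ _ => //.
    by rewrite -xs -yt (comp_eq xv) (comp_eq yv).
  (* An edge leaving [D] outside [S] would end in a reached vertex, possibly one of [T :\ j], and so
     make its origin reached too. Thus [D] is closed and spreads to [b j], which is trivially
     reached. *)
  have : b j \in D.
    apply: (k_connected_closed kG cardS _ (x := v)).
    - move=> x y; rewrite [x \in D]inE => /and3P[xv xU nx].
      rewrite in_setU1 in_setI negb_or negb_and => /andP[yj yU] xy.
      have [yT | yT] := boolP (y \in T).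
        case/negP: nx; apply: connect_trans (reachT y yT yj) _.
        by apply: stepU; rewrite 1?adj_sym ?(TU y).
      have yv := comp_closed xv (comp_notin vT xv) yT xy.
      rewrite yv orbF in yU; rewrite inE yv yU /=.
      apply: contra nx => ny; apply: connect_trans ny (stepU _ _ _ _ _) => //.
      by rewrite adj_sym.
    - by rewrite inE comp_refl vU.
    - rewrite in_setU1 in_setI (negbTE vU) orbF.
      by apply: contraNneq vT => ->.
    - rewrite in_setU1 in_setI (negbTE bjU) orbF.
      by apply: contraNneq bjT => ->.
  by rewrite inE connect0 !andbF.
have reach v : v \notin U -> connect e (b j) v.
  move=> vU; have [vT | vT] := boolP (v \in T); last exact: reachC.
  have [-> | vj] := eqVneq v j; last exact: reachT.
  have wT : w \notin T.
    by apply/negP => wT; have /independentP/(_ j w jT wT) := indT; rewrite jw.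
  apply: connect_trans (reachC w wT wU) (stepU _ _ wU _ _).
    exact: TU.
  by rewrite adj_sym.
apply/forall_inP => x; rewrite inE => xU.
apply/forall_inP => y; rewrite inE => yU.
by apply: connect_trans (reach y yU); rewrite induced_connect_sym reach.
Qed.

(** Fix a neighbour [y] of some [j != t] in this component. Moving [b t] to any other vertex [z] of
    the component leaves a transversal, and [adj_transversal] puts [y] among its values; the only
    value in this component is [z], so [z = y]. *)
Lemma transversal_comp1 b t x :
  transversal b -> t \in T -> x \in comp (b t) -> x = b t.
Proof.
move=> tb tT.
have [j] : exists j, j \in T :\ t.
  by apply/card_gt0P; rewrite card_T_setD1 //; apply: leq_trans k_ge3.
move=> /setD1P[jt jT].
have [y yt jy] := avoiding_touch jT tT jt (tb t tT).
have eqy z : z \in comp (b t) -> z = y.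
  move=> zt; pose b' s := if s == t then z else b s.
  have tb' : transversal b'.
    move=> s sT; rewrite /b'; case: eqP => [->|_]; last exact: tb.
    exact: avoiding_comp (tb t tT) zt.
  have /imsetP[s] := adj_transversal tb' jT jy.
  rewrite !inE /b' => /andP[_ sT]; case: eqP => [_ ->//|st ybs].
  case: st; apply: transversal_comp_inj tb sT tT _; rewrite ybs in yt.
  exact: comp_eq.
by move=> xt; rewrite (eqy x xt) (eqy (b t)) ?comp_refl.
Qed.

Lemma exists_transversal : exists b, transversal b.
Proof.
(* The default [t] is never taken on [T], where an avoiding vertex exists. *)
exists (fun t => odflt t [pick x | avoiding t x]) => t tT.
case: pickP => //= none; have [x] := exists_avoiding tT.
by rewrite none.
Qed.

Lemma transversal_adj b s t :
  transversal b -> s \in T -> t \in T -> adj s (b t) = (s != t).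
Proof.
move=> tb sT tT; have [->|st] := eqVneq s t.
  have /andP[_ /forall_inP av] := tb t tT.
  by apply/negbTE/av; exact: comp_refl.
have [y yt sy] := avoiding_touch sT tT st (tb t tT).
by rewrite -(transversal_comp1 tb tT yt).
Qed.

(** As [G] is connected, some [s] in [T] has a neighbour in [comp v]. That neighbour is some [b r],
    so [comp v] is the singleton component of [b r]. *)
Lemma transversal_cover b v : transversal b -> v \notin T -> v \in b @: T.
Proof.
move=> tb vT.
have [t] : exists t, t \in T by apply/card_gt0P; rewrite cardT.
move=> tT.
have : [exists s in T, [exists y in comp v, adj s y]].
  apply: contraT => /exists_inPn na.
  have : t \in comp v.
    apply: (k_connected_closed kG (S := set0) _ _ (comp_refl v));
      rewrite ?inE ?cards0 //; first exact: leq_trans k_ge3.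
    move=> x y xv _ xy; apply: (comp_closed xv (comp_notin vT xv) _ xy).
    apply/negP => /na/negP; apply; apply/exists_inP; exists x => //.
    by rewrite adj_sym.
  by move/(comp_notin vT); rewrite tT.
move=> /exists_inP[s sT /exists_inP[y yv sy]].
have /imsetP[r] := adj_transversal tb sT sy; rewrite !inE => /andP[_ rT] yr.
apply/imsetP; exists r => //; apply: transversal_comp1 tb rT _.
by rewrite -yr (comp_eq yv) comp_refl.
Qed.

End Transversal.

(** Coordinates in [bool * 'I_s] treat both sides alike: adjacency means that side and index both
    differ. *)
Lemma isomorphic_KssPMP (G : sgraph) (s : nat) :
  isomorphic G (KssPM s) <->
  exists2 h : bool * 'I_s -> G, bijective h
    & forall p q, adj (h p) (h q) = (p.1 != q.1) && (p.2 != q.2).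
Proof.
pose c (p : bool * 'I_s) : KssPM s := if p.1 then inl p.2 else inr p.2.
pose d (x : KssPM s) : bool * 'I_s :=
  match x with inl i => (true, i) | inr i => (false, i) end.
have cK : cancel c d by case=> [[] i].
have dK : cancel d c by case=> i.
have adjc p q : adj (c p) (c q) = (p.1 != q.1) && (p.2 != q.2).
  by case: p q => [[] i] [[] j].
split=> [[f [g fK gK] adjf] | [h [g hK gK] adjh]].
  exists (fun p => g (c p)); last by move=> p q; rewrite -adjf !gK adjc.
  by exists (d \o f) => x /=; rewrite ?gK ?cK ?dK ?fK.
exists (fun x => c (g x)).
  by exists (h \o d) => x /=; rewrite ?cK ?gK ?hK ?dK.
by move=> x y; rewrite adjc -adjh !gK.
Qed.

(** * The complete bipartite graph minus a perfect matching satisfies the three conditions *)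

Section Crown.
Variables (G : sgraph) (k : nat) (h : bool * 'I_k.+1 -> G).
Hypotheses (k_ge3 : 3 <= k) (bij_h : bijective h).
Hypothesis adj_h :
  forall p q, adj (h p) (h q) = (p.1 != q.1) && (p.2 != q.2).
Implicit Types (S D E : {set G}) (c : bool).

Lemma crown_surj x : exists c i, x = h (c, i).
Proof.
have [g _ gK] := bij_h.
by exists (g x).1, (g x).2; rewrite -surjective_pairing gK.
Qed.

Definition side c : {set G} := [set h (c, i) | i : 'I_k.+1].

Lemma side_inj c : injective (fun i => h (c, i)).
Proof. by move=> i j /(bij_inj bij_h)[]. Qed.

Lemma card_side c : #|side c| = k.+1.
Proof. by rewrite card_imset ?card_ord //; apply: side_inj. Qed.

Lemma card_crown : #|G| = k.+1.*2.
Proof. by rewrite -(bij_eq_card bij_h) card_prod card_bool card_ord mul2n. Qed.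

Lemma two_on_side D : 2 < #|D| ->
  exists c i j, [/\ i != j, h (c, i) \in D & h (c, j) \in D].
Proof.
have [g hK gK] := bij_h => D_gt2.
have /dinjectivePn[x xD [y]] : ~~ dinjectiveb (fun x => (g x).1) (mem D).
  apply/negP => /dinjectiveP /leq_card_in; rewrite card_bool => D_le2.
  by rewrite ltnNge D_le2 in D_gt2.
rewrite !inE => /andP[yx yD] gxy.
exists (g x).1, (g x).2, (g y).2; split.
- apply: contra yx => /eqP gxy2; rewrite -(gK x) -(gK y).
  by rewrite (surjective_pairing (g x)) gxy gxy2 -surjective_pairing.
- by rewrite -surjective_pairing gK.
- by rewrite gxy -surjective_pairing gK.
Qed.

(** A vertex has only one non-neighbour on the opposite side, the one with its own index. *)
Lemma adj_two_on_side c i j l :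
  i != j -> adj (h (c, i)) (h (~~ c, l)) || adj (h (c, j)) (h (~~ c, l)).
Proof.
move=> ij; rewrite !adj_h /=; case: (eqVneq i l) ij => [->|_ _].
  by rewrite eq_sym => ->; case: c.
by case: c.
Qed.

(** Two vertices of [D] on side [c] together dominate the opposite side, so [E] lies in side [c].
    The [k] neighbours of any [y] in [E] are then outside [E], and outside [D] because [y] has no
    neighbour there. *)
Lemma crown_separator_large D E :
    {in D & E, forall x y, ~~ adj x y} -> E != set0 -> 2 < #|D| ->
  k <= #|~: (D :|: E)|.
Proof.
move=> nDE /set0Pn[y yE] /two_on_side[c [i [j [ij iD jD]]]].
have nE l : h (~~ c, l) \notin E.
  apply/negP => lE; have := adj_two_on_side c l ij.
  by rewrite (negbTE (nDE _ _ iD lE)) (negbTE (nDE _ _ jD lE)).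
have [c' [m ym]] := crown_surj y.
have cc : c' = c.
  apply: contraTeq yE; rewrite eq_sym negb_eqb ym => /addbP <-.
  exact: nE.
rewrite cc in ym.
rewrite -[k]/(k.+1.-1) -(card_ord k.+1) -(cardC1 m).
rewrite -(card_imset _ (@side_inj (~~ c))); apply/subset_leq_card/subsetP.
move=> _ /imsetP[l lm ->]; rewrite !inE negb_or nE andbT.
apply/negP => lD; have := nDE _ _ lD yE; rewrite ym adj_h /= => /negP; apply.
by move: lm; rewrite inE => ->; rewrite andbT; case: (c).
Qed.

Lemma crown_k_connected : k_connected G k.
Proof.
apply/andP; split.
  by rewrite card_crown -addnn addSn ltnS leq_addr.
apply/forallP => S; apply/implyP => S_lt; apply/connected_onP.
move=> D0 clD x y xD xS yS; apply/negPn/negP => yD.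
(* The set [D0] may meet [S]; these two parts cover [G - S] with no edge between them. *)
pose D := D0 :\: S; pose E := ~: S :\: D0.
have nDE : {in D & E, forall u v, ~~ adj u v}.
  move=> u v /setDP[uD uS] /setDP[vS vD]; apply: contra vD => uv.
  exact: clD uv.
have D0' : D != set0 by apply/set0Pn; exists x; rewrite !inE xD andbT -in_setC.
have E0' : E != set0 by apply/set0Pn; exists y; rewrite in_setD yD.
have DES : ~: (D :|: E) = S.
  by apply/setP => z; rewrite !inE; case: (z \in S); case: (z \in D0).
have D_le2 : #|D| <= 2.
  rewrite leqNgt; apply/negP => /(crown_separator_large nDE E0').
  by rewrite DES leqNgt S_lt.
have E_le2 : #|E| <= 2.
  rewrite leqNgt; apply/negP => E_gt2.
  have nED : {in E & D, forall u v, ~~ adj u v}.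
    by move=> u v uE vD; rewrite adj_sym nDE.
  by have := crown_separator_large nED D0' E_gt2; rewrite setUC DES leqNgt S_lt.
(* With both parts of size at most 2, counting vertices gives [2k + 2 <= 4 + k], against
   [k >= 3]. *)
have := cardsC (D :|: E); rewrite DES card_crown => cardG.
have DE_le4 : #|D :|: E| <= 2 + 2.
  exact: leq_trans (leq_card_setU _ _) (leq_add D_le2 E_le2).
have : k.+1.*2 <= 2 + 2 + k by rewrite -cardG leq_add // ltnW.
by rewrite -addnn -addSnnS leq_add2r leqNgt !ltnS k_ge3.
Qed.

Lemma side_independent c : independent (side c).
Proof.
by apply/independentP => _ _ /imsetP[i _ ->] /imsetP[j _ ->]; rewrite adj_h eqxx.
Qed.

Lemma crown_independence : k < independence_number G.
Proof.
rewrite -(card_side true) /independence_number.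
by rewrite (bigD1 (side true)) ?side_independent //= leq_maxl.
Qed.

(** Since [k >= 3], two vertices of [S] share a side [c], which forces [S] to be [side c] minus one
    vertex [x]. Deleting [S] isolates the vertex matched with [x]. *)
Lemma crown_cut S : independent S -> #|S| = k -> vertex_cut S.
Proof.
move=> /independentP iS cardS.
have [|c [i [j [ij iS' jS']]]] := @two_on_side S; first by rewrite cardS.
have oppS l : h (~~ c, l) \notin S.
  apply/negP => lS; have := adj_two_on_side c l ij.
  by rewrite (negbTE (iS _ _ iS' lS)) (negbTE (iS _ _ jS' lS)).
have subS : S \subset side c.
  apply/subsetP => x; have [c' [m ->]] := crown_surj x => mS.
  have [<-|] := eqVneq c c'; first exact: imset_f.
  by rewrite negb_eqb => /addbP cc; move: (oppS m); rewrite cc mS.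
have /cards1P[x Sx] : #|side c :\: S| == 1.
  by rewrite cardsD (setIidPr subS) card_side cardS subSnn.
have /setDP[/imsetP[l _ xl] xS] : x \in side c :\: S by rewrite Sx set11.
rewrite /vertex_cut; apply/connected_onP => clS.
suff : x \in [set h (~~ c, l)].
  by rewrite xl => /set1P/(bij_inj bij_h)[]; case: (c).
apply: (clS _ _ (h (~~ c, l))); rewrite ?inE //.
move=> _ v /set1P->; rewrite in_setC; have [c' [m ->]] := crown_surj v.
rewrite adj_h /= => mS /andP[cc lm]; case/negP: mS.
rewrite negb_eqb addNb -negb_eqb negbK in cc; rewrite -(eqP cc).
apply/negPn/negP => mS; have : h (c, m) \in side c :\: S.
  by rewrite in_setD mS imset_f.
by rewrite Sx xl => /set1P /side_inj ml; rewrite ml eqxx in lm.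
Qed.

End Crown.

(** * Assembling the two directions of the characterization *)

Theorem theorem1 (k : nat) (k_ge3 : 3 <= k) (G : sgraph) :
  [/\ k_connected G k,
      k < independence_number G
    & forall S : {set G}, independent S -> #|S| = k -> vertex_cut S]
  <-> isomorphic G (KssPM k.+1).
Proof.
split=> [[kG alphaG cutG] | /isomorphic_KssPMP[h bij_h adj_h]]; last first.
  split; first exact: crown_k_connected bij_h adj_h.
    exact: crown_independence bij_h adj_h.
  exact: crown_cut bij_h adj_h.
have [T indT cardT] := independent_of_card alphaG.
have [b tb] := exists_transversal indT cardT cutG.
have adjb := transversal_adj k_ge3 kG indT cardT cutG tb.
have binj := transversal_inj kG cardT tb.
pose t (i : 'I_k.+1) : G := enum_val (cast_ord (esym cardT) i).
have tT i : t i \in T by apply: enum_valP.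
have tinj : injective t by move=> i j /enum_val_inj/cast_ord_inj.
have tsurj x : x \in T -> exists i, x = t i.
  move=> xT; exists (cast_ord cardT (enum_rank_in xT x)).
  by rewrite /t cast_ordK enum_rankK_in.
(* One side is [T], the other its transversal; the deleted matching pairs each [t i] with
   [b (t i)]. *)
pose h (p : bool * 'I_k.+1) := if p.1 then t p.2 else b (t p.2).
apply/isomorphic_KssPMP; exists h.
  have inj_h : injective h.
    rewrite /h => -[[] i] [[] j] /= => [/tinj-> //|tb_ij|tb_ij|/binj e].
    - by have := transversal_notin tb (tT j); rewrite -tb_ij tT.
    - by have := transversal_notin tb (tT i); rewrite tb_ij tT.
    - by rewrite (tinj _ _ (e (tT i) (tT j))).
  have /fin_all_exists[g gK] : forall x, exists p, h p = x.
    move=> x; have [/tsurj[i ->]|xT] := boolP (x \in T).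
      by exists (true, i).
    have := transversal_cover k_ge3 kG indT cardT cutG tb xT.
    by move=> /imsetP[_ /tsurj[i ->] ->]; exists (false, i).
  by exists g => // p; apply: inj_h; rewrite gK.
move=> [[] i] [[] j]; rewrite /h /=.
- by apply/negbTE; move/independentP: indT; apply.
- by rewrite adjb // (inj_eq tinj).
- by rewrite adj_sym adjb // (inj_eq tinj) eq_sym.
- by apply/negbTE; apply: (transversal_nadj kG cardT tb).
Qed.
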